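(* For every cardinal $\mathfrak m$, there exists a family $\{K_i : i\in I\}$ of bounded lattices with $|I|=\mathfrak m$ such that every $K_i$ is simple and the family is mutually rigid.
   Context: A family $\{K_i : i\in I\}$ of bounded lattices is called mutually rigid if, for all $i\neq j$ in $I$, there is no $\{0,1\}$-embedding of $K_i$ into $K_j$ (a $\{0,1\}$-embedding is an injective lattice homomorphism preserving the least and greatest elements). A lattice is simple if it has exactly two congruences (the trivial and the total one). *)

(* Defs.v *)
From HB Require Import structures.
From mathcomp Require Import all_boot all_order.
Set Implicit Arguments. Unset Strict Implicit. Unset Printing Implicit Defensive.
Import Order.TTheory.
Local Open Scope order_scope.

Definition bl_embedding (d1 d2 : Order.disp_t)
  (K1 : tbLatticeType d1) (K2 : tbLatticeType d2) (f : K1 -> K2) : Prop :=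
  [/\ injective f,
      (forall x y : K1, f (x `&` y) = f x `&` f y),
      (forall x y : K1, f (x `|` y) = f x `|` f y),
      f \bot = \bot & f \top = \top].

Definition lattice_congruence (d : Order.disp_t) (K : latticeType d)
  (R : K -> K -> Prop) : Prop :=
  [/\ (forall x, R x x),
      (forall x y, R x y -> R y x),
      (forall x y z, R x y -> R y z -> R x z),
      (forall x1 y1 x2 y2, R x1 y1 -> R x2 y2 -> R (x1 `&` x2) (y1 `&` y2)) &
      (forall x1 y1 x2 y2, R x1 y1 -> R x2 y2 -> R (x1 `|` x2) (y1 `|` y2))].

Definition simple_lattice (d : Order.disp_t) (K : latticeType d) : Prop :=
  (exists x y : K, x <> y) /\
  forall R : K -> K -> Prop, lattice_congruence R ->
    (forall x y, R x y <-> x = y) \/ (forall x y, R x y).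

Definition mutually_rigid (I : Type) (d : I -> Order.disp_t)
  (K : forall i, tbLatticeType (d i)) : Prop :=
  forall i j : I, i <> j -> ~ exists f : K i -> K j, bl_embedding f.

(* Main.v *)
Require Import Defs.
From HB Require Import structures.
From mathcomp Require Import all_boot all_order.
From mathcomp Require Import boolp wochoice.

(* The lattices have length four and encode digraphs. Each vertex v is a block of
   two points (v, true), (v, false); the elements are the empty set, the points,
   the blocks, the unions of the block of v with the point (w, true) for v -> w,
   and the whole set. A chain of length four has to be mapped to a chain of
   length four, so an embedding sends blocks to blocks and yields an injection of
   vertices that preserves the arrows, and preserves non-adjacency because two
   points in non-adjacent blocks join to the top. Simplicity holds as points are
   closed and every point has two mutually disjoint complements.

   It remains to find enough mutually rigid digraphs. Take a well-order X with a
   last element, containing I, and on X * nat the arrows (x, 0) -> (y, 0) for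
   x < y, (x, n) -> (x, n + 1) and (x, n + 2) -> (g x n, 0). Since X is large,
   degrees identify level 0, so an embedding comes from a strictly increasing
   h : X -> X commuting with g. If n |-> g x (n + 1) is a sequence cofinal in x
   and below x whenever x has countable cofinality, then h is the identity by the
   argument of Kunen's inconsistency theorem and of the rigid relations of
   Vopenka, Pultr and Hedrlin. The value g x 0 is free, and is used to mark the
   index i. *)
Set Implicit Arguments. Unset Strict Implicit. Unset Printing Implicit Defensive.
Import Order.TTheory.
Local Open Scope order_scope.

(* Closure is only required under the two-point rule "r lies on every member of
   F through p and q"; this keeps all members of F and is stable under arbitrary
   intersections. *)
Record flat (P : Type) (F : (P -> Prop) -> Prop) := Flat {
  pts :> P -> Prop;
  ptsP : forall p q r, pts p -> pts q ->
    (forall g, F g -> g p -> g q -> g r) -> pts r }.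

(** * The bounded lattice of flats *)

Section FlatLattice.
Context {P : Type} {F : (P -> Prop) -> Prop}.
Implicit Types A B C : flat F.

Lemma flat_ext A B : (forall p, A p <-> B p) -> A = B.
Proof.
case: A B => [a aP] [b bP] /= eq_ab.
have eab : a = b by apply/funext => p; apply/propext.
by case: _ / eab in bP eq_ab *; congr Flat; apply: Prop_irrelevance.
Qed.

HB.instance Definition _ := gen_eqMixin (flat F).
HB.instance Definition _ := gen_choiceMixin (flat F).

Definition flat_le A B := `[< forall p, A p -> B p >].

Fact flat_le_refl : reflexive flat_le.
Proof. by move=> A; apply/asboolP. Qed.

Fact flat_le_anti : antisymmetric flat_le.
Proof.
move=> A B /andP[/asboolP AB /asboolP BA].
by apply: flat_ext => p; split; [exact: AB | exact: BA].
Qed.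

Fact flat_le_trans : transitive flat_le.
Proof.
by move=> B A C /asboolP AB /asboolP BC; apply/asboolP => p /AB /BC.
Qed.

HB.instance Definition _ := Order.Le_isPOrder.Build (Order.Disp tt tt) (flat F)
  flat_le_refl flat_le_anti flat_le_trans.

Lemma flat_leP A B : reflect (forall p, A p -> B p) (A <= B).
Proof. exact: asboolP. Qed.

Definition flat_meet A B : flat F.
exists (fun p => A p /\ B p) => p q r [Ap Bp] [Aq Bq] pqr.
by split; [exact: (ptsP Ap Aq) | exact: (ptsP Bp Bq)].
Defined.

Definition flat_join A B : flat F.
exists (fun p => forall C, A <= C -> B <= C -> C p) => p q r Hp Hq pqr C AC BC.
exact: (ptsP (Hp C AC BC) (Hq C AC BC)).
Defined.

Definition flat_bot : flat F.
by exists (fun=> False).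
Defined.

Definition flat_top : flat F.
by exists (fun=> True).
Defined.

Fact flat_meetP A B C : (A <= flat_meet B C) = (A <= B) && (A <= C).
Proof.
apply/flat_leP/andP => [ABC | [/flat_leP AB /flat_leP AC] p Ap].
  by split; apply/flat_leP => p /ABC [].
by split; [exact: AB | exact: AC].
Qed.

Fact flat_joinP A B C : (flat_join A B <= C) = (A <= C) && (B <= C).
Proof.
apply/flat_leP/andP => [ABC | [AC BC] p]; last exact.
split; apply/flat_leP => p Hp; apply: ABC => D /flat_leP AD /flat_leP BD.
  exact: AD.
exact: BD.
Qed.

HB.instance Definition _ :=
  Order.POrder_MeetJoin_isLattice.Build _ (flat F) flat_meetP flat_joinP.

Fact flat_le0 A : flat_bot <= A. Proof. by apply/flat_leP. Qed.
Fact flat_le1 A : A <= flat_top. Proof. by apply/flat_leP. Qed.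

HB.instance Definition _ := Order.hasBottom.Build _ (flat F) flat_le0.
HB.instance Definition _ := Order.hasTop.Build _ (flat F) flat_le1.

Lemma flat_topP A : (forall p, A p) -> A = \top.
Proof. by move=> AP; apply/eqP; rewrite -le1x; apply/flat_leP. Qed.

Lemma flat_botP A : (forall p, ~ A p) -> A = \bot.
Proof. by move=> AP; apply/eqP; rewrite -lex0; apply/flat_leP => p /AP. Qed.

(** If no member of [F] contains both points, the two-point rule is vacuous and puts every point
    into [A]. *)
Lemma proper_flat_span A p q : A != \top -> A p -> A q ->
  exists g, [/\ F g, g p & g q].
Proof.
move=> /eqP AT Ap Aq; apply: contrapT => nog; apply: AT.
by apply: flat_topP => r; apply: (ptsP Ap Aq) => g Fg gp gq; case: nog; exists g.
Qed.

Definition flat_of g (Fg : F g) : flat F.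
by exists g => p q r gp gq; apply.
Defined.

End FlatLattice.

(** * A criterion for simplicity *)

(** Meeting a collapsed pair [x < y] with [w] gives a nonzero element congruent to [\bot]. Joining
    with [u] and [v] makes both congruent to [\top], hence also their meet [\bot]. *)
Lemma simple_lattice_criterion (d : Order.disp_t) (K : tbLatticeType d) :
  (exists x y : K, x <> y) ->
  (forall y : K, y != \bot ->
     exists u v : K, [/\ u `|` y = \top, v `|` y = \top & u `&` v = \bot]) ->
  (forall x y : K, x < y -> exists2 w : K, w `&` x = \bot & w `&` y != \bot) ->
  simple_lattice K.
Proof.
move=> nontriv compl sep; split=> // R [Rr Rs Rt RI RU].
have [[x [y [Rxy /eqP neq_xy]]] | noR] := pselect (exists x y, R x y /\ x <> y); last first.
  left=> x y; split=> [Rxy | -> //].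
  by apply: contrapT => neq; apply: noR; exists x, y.
right.
suff R01 : R \bot \top.
  move=> a b; have R0 c : R \bot c by rewrite -[\bot](meetx0 c) -{2}[c]meetx1; exact: RI.
  exact: Rt (Rs _ _ (R0 a)) (R0 b).
have Rlt : R (x `&` y) (x `|` y).
  apply: Rt (_ : R y _).
    by rewrite -{2}[y]meetxx; apply: RI.
  by rewrite -{1}[y]joinxx; apply: RU => //; apply: Rs.
have ltIU : x `&` y < x `|` y.
  rewrite lt_neqAle (le_trans (leIl x y) (leUl x y)) andbT.
  apply: contra neq_xy => /eqP eqIU.
  have xUI : x `|` y <= x `&` y by rewrite eqIU.
  rewrite eq_le (le_trans (leUl x y) (le_trans xUI (leIr y x))).
  exact: le_trans (leUr y x) (le_trans xUI (leIl x y)).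
have [w w0 wn0] := sep _ _ ltIU.
have {}Rlt : R \bot (w `&` (x `|` y)) by rewrite -w0; apply: RI.
have [u [v [uT vT uv]]] := compl _ wn0.
have R1 c : c `|` (w `&` (x `|` y)) = \top -> R c \top.
  by move=> <-; rewrite -{1}[c]joinx0; apply: RU.
by rewrite -uv -[\top]meetxx; apply: RI; apply: R1.
Qed.

(** * The lattice of a digraph *)

Inductive patch (V : Type) (E : V -> V -> Prop) : (V * bool -> Prop) -> Prop :=
| Point p : patch E (fun q => q = p)
| Block v : patch E (fun q => q.1 = v)
| Edge v w of E v w : patch E (fun q => q.1 = v \/ q = (w, true)).

Definition asym (V : Type) (E : V -> V -> Prop) := forall v w, E v w -> ~ E w v.

Section DigraphLattice.
Context {V : Type} {E : V -> V -> Prop} (Easym : asym E).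
Implicit Types (A : flat (patch E)) (p q r : V * bool) (v w : V).

(** With asymmetry only one alternative can hold, so at most one patch passes through two points of
    different blocks. *)
Lemma patch_cross g p q : patch E g -> g p -> g q -> p.1 <> q.1 ->
  [/\ E p.1 q.1, q.2 = true & forall r, g r <-> r.1 = p.1 \/ r = q] \/
  [/\ E q.1 p.1, p.2 = true & forall r, g r <-> r.1 = q.1 \/ r = p].
Proof.
case=> [s -> -> // | v -> -> // | v w Evw [pv|->] [qv|->] //=].
- by rewrite pv qv.
- by left; split=> // [|r]; rewrite pv.
- by right; split=> // [|r]; rewrite qv.
Qed.

Lemma proper_flat_adj A p q : A != \top -> A p -> A q -> p.1 <> q.1 ->
  E p.1 q.1 \/ E q.1 p.1.
Proof.
move=> AT Ap Aq pq; have [g [Fg gp gq]] := proper_flat_span AT Ap Aq.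
by have [[]|[]] := patch_cross Fg gp gq pq; [left | right].
Qed.

(** A patch through both points contains the source block. If [q.2] is [false] there is no such
    patch, and the rule is vacuous. *)
Lemma flat_fill A p q : A p -> A q -> E p.1 q.1 -> forall b, A (p.1, b).
Proof.
move=> Ap Aq Epq b; apply: (ptsP Ap Aq) => g Fg gp gq.
have pq : p.1 <> q.1 by move=> pq; move: (Epq); rewrite pq => /[dup] /Easym.
have [[_ _ ->]|[/Easym]//] := patch_cross Fg gp gq pq.
by left.
Qed.

Lemma proper_flat_block A p q : A != \top -> A p -> A q -> p <> q ->
  exists v, forall b, A (v, b).
Proof.
move=> AT Ap Aq pq; have [pq1|pq1] := pselect (p.1 = q.1); last first.
  have [/(flat_fill Ap Aq)|/(flat_fill Aq Ap)] := proper_flat_adj AT Ap Aq pq1.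
    by exists p.1.
  by exists q.1.
exists p.1 => b; case: p q Ap Aq pq pq1 => [v c] [w e] /= Ap Aq pq eq_vw.
rewrite -eq_vw in Aq pq.
have [->|nbc] := eqVneq b c; first by [].
suff -> : b = e by [].
by move: pq nbc; case: b; case: c {Ap}; case: e {Aq}.
Qed.

(** Points outside the block are [true] points of out-neighbours of [v]. Two of them would be
    adjacent, and [flat_fill] would add a [false] one. *)
Lemma proper_flat_block_or_edge A v : A != \top -> (forall b, A (v, b)) ->
  (forall r, A r <-> r.1 = v) \/
  exists2 w, E v w & forall r, A r <-> r.1 = v \/ r = (w, true).
Proof.
move=> AT Av.
have out r : A r -> r.1 <> v -> E v r.1 /\ r = (r.1, true).
  (* The point [(v, false)] lies in no patch of an arrow into [v]. *)
  move=> Ar rv; have [g [Fg gv gr]] := proper_flat_span AT (Av false) Ar.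
  have [[Evr r2 _]|[]//] := patch_cross Fg gv gr (nesym rv).
  by split=> //; rewrite -r2; case: (r).
have [[r Ar rv]|noout] := pselect (exists2 r, A r & r.1 <> v); last first.
  left=> r; split=> [Ar|]; last by case: r => w b /= ->.
  by apply: contrapT => rv; apply: noout; exists r.
right; have [Evr rE] := out r Ar rv; exists r.1 => // s; split=> [As|]; last first.
  by rewrite -rE => -[|-> //]; case: s => w b /= ->.
have [sv|sv] := pselect (s.1 = v); first by left.
right; have [Evs sE] := out s As sv; rewrite sE; congr pair.
apply: contrapT => sr.
have [/(flat_fill As Ar)|/(flat_fill Ar As)] := proper_flat_adj AT As Ar sr.
  by move=> /(_ false) /out /(_ sv) [].
by move=> /(_ false) /out /(_ rv) [].
Qed.

Lemma digraph_lattice_simple :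
  (forall v, exists u u', [/\ u <> u',
     [/\ v <> u, ~ E v u & ~ E u v] & [/\ v <> u', ~ E v u' & ~ E u' v]]) ->
  inhabited V -> simple_lattice (flat (patch E)).
Proof.
move=> far [v0]; apply: simple_lattice_criterion.
- exists \bot, \top => bT.
  by have : (\bot : flat (patch E)) (v0, true) by rewrite bT.
- move=> A /eqP A0; have [[v b] Av] : exists p, A p.
    by apply: contrapT => noA; apply: A0; apply: flat_botP => p Ap; apply: noA; exists p.
  have joinT u : [/\ v <> u, ~ E v u & ~ E u v] ->
    flat_of (Point E (u, true)) `|` A = \top.
    move=> [vu Evu Euv]; apply: contrapT => /eqP JT.
    have Jv : (flat_of (Point E (u, true)) `|` A : flat _) (v, b).
      by move/flat_leP: (leUr A (flat_of (Point E (u, true)))); apply.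
    have Ju : (flat_of (Point E (u, true)) `|` A : flat _) (u, true).
      by move/flat_leP: (leUl (flat_of (Point E (u, true))) A); apply.
    by have [] := proper_flat_adj JT Jv Ju vu.
  have [u [u' [uu' Hu Hu']]] := far v.
  exists (flat_of (Point E (u, true))), (flat_of (Point E (u', true))).
  split; [exact: joinT | exact: joinT |].
  by apply: flat_botP => p /= [-> [/uu']].
- move=> A B /[dup] /ltW /flat_leP AB ltAB.
  have [p Bp Ap] : exists2 p, B p & ~ A p.
    apply: contrapT => noB; move: ltAB; rewrite lt_leAnge => /andP[_ /negP]; apply.
    apply/flat_leP => p Bp; apply: contrapT => Ap; apply: noB; exists p => //.
  exists (flat_of (Point E p)).
    by apply: flat_botP => q /= [->].
  apply/eqP => w0; suff : (\bot : flat (patch E)) p by [].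
  by rewrite -w0.
Qed.

End DigraphLattice.

(** * From lattice embeddings to digraph embeddings *)

Section Embedding.
Context {V V' : Type} {E : V -> V -> Prop} {E' : V' -> V' -> Prop}.
Context (Easym : asym E) (Easym' : asym E') (Eserial : forall v, exists w, E v w).
Context (f : flat (patch E) -> flat (patch E')) (femb : bl_embedding f).

Local Notation pt := (fun p => flat_of (Point E p)).
Local Notation blk := (fun v => flat_of (Block E v)).
Local Notation edg := (fun h => flat_of (Edge h)).

Implicit Types A B : flat (patch E).

Let finj : injective f. Proof. by case: femb. Qed.

Let fmono A B p : A <= B -> f A p -> f B p.
Proof.
by case: femb => _ fI _ _ _ /meet_l AB; rewrite -{1}AB fI => -[].
Qed.

Let fproper A : A != \top -> f A != \top.
Proof. by case: femb => _ _ _ _ <-; rewrite (inj_eq finj). Qed.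

Let finhab A p : A p -> exists q, f A q.
Proof.
move=> Ap; apply: contrapT => noA.
have : f A = f \bot.
  by case: femb => _ _ _ -> _; apply: flat_botP => q Aq; apply: noA; exists q.
by move/finj => A0; rewrite A0 in Ap.
Qed.

Let fstrict A B p : A <= B -> B p -> ~ A p -> exists2 q, f B q & ~ f A q.
Proof.
move=> AB Bp Ap; apply: contrapT => noq; apply: Ap.
suff /finj -> : f A = f B by [].
apply: flat_ext => q; split; first exact: fmono.
by move=> Bq; apply: contrapT => Aq; apply: noq; exists q.
Qed.

Let irr v w : E v w -> v <> w.
Proof. by move=> /[swap] -> /[dup] /Easym. Qed.

(** The image of the block has two points, so it contains a block. Were it an edge patch, the
    strictly larger image of an edge above it would be a proper flat that the classification
    excludes. *)
Lemma embedding_block v : exists u, forall r, f (blk v) r <-> r.1 = u.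
Proof.
have [w Evw] := Eserial v.
have [p fp] : exists p, f (pt (v, true)) p by apply: finhab; exact: erefl.
have pb : pt (v, true) <= blk v by apply/flat_leP => q /= ->.
have be : blk v <= edg Evw by apply/flat_leP => q /= ->; left.
have [q fq pq] : exists2 q, f (blk v) q & ~ f (pt (v, true)) q.
  by apply: (fstrict (p := (v, false)) pb).
have [r fr qr] : exists2 r, f (edg Evw) r & ~ f (blk v) r.
  by apply: (fstrict (p := (w, true)) be) => /= [|/esym/irr]; [right | exact].
have eT : f (edg Evw) != \top.
  apply: fproper; apply/eqP => eT.
  have : (edg Evw) (w, false) by rewrite eT.
  by case=> //= /esym /(irr Evw).
have bT : f (blk v) != \top.
  by apply/eqP => bT; apply: qr; rewrite bT.
have pq' : p <> q by move=> pq'; apply: pq; rewrite -pq'.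
have [u bu] := proper_flat_block Easym' bT (fmono pb fp) fq pq'.
have [bE|[z Euz bE]] := proper_flat_block_or_edge Easym' bT bu; first by exists u.
have eu b : f (edg Evw) (u, b) by apply: (fmono be).
have ez : f (edg Evw) (z, true) by apply: (fmono be); apply/bE; right.
have uz : u <> z by move=> uz; move: Euz; rewrite uz => /[dup] /Easym'.
have [eE|[z' Euz' eE]] := proper_flat_block_or_edge Easym' eT eu.
  by move/eE: ez => /esym.
move/eE: ez => /= [/esym //|[zz']]; case: qr; apply/bE; rewrite zz'; exact/eE.
Qed.

(** The image is nonempty and misses a point of a two-point block. The bit [c] is left open since
    [f] may swap the points of a block. *)
Lemma embedding_point v u : (forall r, f (blk v) r <-> r.1 = u) ->
  forall b, exists c, forall r, f (pt (v, b)) r <-> r = (u, c).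
Proof.
move=> bE b; have [[w c] fc] : exists p, f (pt (v, b)) p.
  by apply: finhab; exact: erefl.
have pb : pt (v, b) <= blk v by apply/flat_leP => q /= ->.
have wu : w = u by move/bE: (fmono pb fc).
rewrite wu in fc.
exists c => r; split=> [fr|-> //]; apply: contrapT => rc.
have [q /bE qu] : exists2 q, f (blk v) q & ~ f (pt (v, b)) q.
  by apply: (fstrict (p := (v, ~~ b)) pb) => //= -[]; case: (b).
apply; move/bE: (fmono pb fr); case: r fr rc => [r1 r2] /= fr rc ru.
rewrite {}ru in fr rc; case: q qu => [q1 q2] /= ->.
have [->|] := eqVneq q2 c; first by [].
suff [->//|->] : q2 = r2 \/ q2 = c by rewrite eqxx.
by case: q2; case: r2 {fr} rc; case: c {fc}; auto.
Qed.

Lemma digraph_embedding : exists2 s : V -> V', injective s &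
  (forall v w, E v w -> E' (s v) (s w)) /\
  (forall v w, E' (s v) (s w) -> E v w \/ E w v).
Proof.
have [s sE] := choice embedding_block.
have sinj : injective s.
  move=> v w svw; suff /finj bvw : f (blk v) = f (blk w).
    by have : (blk w) (v, true) by rewrite -bvw.
  by apply: flat_ext => r; rewrite sE svw sE.
have sP v b := embedding_point (sE v) b.
exists s => //; split=> v w.
  move=> Evw; have be : blk v <= edg Evw by apply/flat_leP => q /= ->; left.
  have eT : f (edg Evw) != \top.
    apply: fproper; apply/eqP => eT.
    have : (edg Evw) (w, false) by rewrite eT.
    by case=> //= /esym /(irr Evw).
  have eu b : f (edg Evw) (s v, b) by apply: (fmono be); apply/sE.
  have [c pE] := sP w true.
  have ew : f (edg Evw) (s w, c).
    apply: (@fmono (pt (w, true))); last exact/pE.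
    by apply/flat_leP => q /= ->; right.
  have svw : s w <> s v by move/sinj/esym/(irr Evw).
  have [eE|[z Euz eE]] := proper_flat_block_or_edge Easym' eT eu.
    by move/eE: ew.
  by move/eE: ew => /= [//|[->]].
move=> Evw'.
have vw : v <> w by move=> vw; move: Evw'; rewrite vw => /[dup] /Easym'.
(* The two points of the block of [w] have distinct images, so one of them goes to [(s w, true)]. *)
have [c wE] : exists c, forall r, f (pt (w, c)) r <-> r = (s w, true).
  have [[] c1E] := sP w true; first by exists true.
  have [[] c2E] := sP w false; first by exists false.
  suff /finj pp : f (pt (w, true)) = f (pt (w, false)).
    by have : (pt (w, false)) (w, true) by rewrite -pp.
  by apply: flat_ext => r; rewrite c1E c2E.
have [b vE] := sP v true.
set J : flat (patch E) := pt (v, true) `|` pt (w, c).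
(* The image of [J] lies in the patch of the arrow from [s v] to [s w], which omits
   [(s w, false)]. *)
have JT : J != \top.
  apply/eqP => JT; have : f J (s w, false).
    by case: femb => _ _ _ _ fT; rewrite JT fT.
  case: femb => _ _ fU _ _; rewrite /J fU => sJ.
  have : f (pt (v, true)) `|` f (pt (w, c)) <= flat_of (Edge Evw').
    rewrite leUx; apply/andP; split; apply/flat_leP => r.
      by move/vE => ->; left.
    by move/wE => ->; right.
  move/flat_leP => /(_ _ sJ) /= [/sinj /esym //|[]//].
have Jv : J (v, true).
  by move/flat_leP: (leUl (pt (v, true)) (pt (w, c))); apply.
have Jw : J (w, c).
  by move/flat_leP: (leUr (pt (w, c)) (pt (v, true))); apply.
exact: (proper_flat_adj JT Jv Jw vw).
Qed.

End Embedding.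

(** * Well-orders with a last element *)

Definition strict_well_order (X : eqType) (lt : rel X) :=
  [/\ irreflexive lt, transitive lt,
      forall x y, x != y -> lt x y || lt y x &
      forall P : X -> Prop, (exists x, P x) ->
        exists2 x, P x & forall y, P y -> ~~ lt y x].

Lemma strict_well_order_exists (T : eqType) :
  exists lt : rel T, strict_well_order lt.
Proof.
have [R Rwo] := well_ordering_principle T.
have Rc : wo_chain R predT by move=> A _; apply: Rwo.
have Rr : reflexive R by move=> x; apply: wo_chain_reflexive Rc _ _.
have Ra : antisymmetric R by move=> x y; apply: wo_chain_antisymmetric Rc _ _ _ _.
have RT : total R by move=> x y; apply: wo_chainW Rc _ _ _ _.
have Rt : transitive R.
  move=> y x z xy yz.
  (* If the least of the three is [y] or [z], antisymmetry identifies it with its predecessor in the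
     chain. *)
  have [|w [[]]] := Rwo (pred3 x y z); first by exists x; rewrite !inE eqxx.
  move=> /or3P[] /eqP -> lb _; first by rewrite lb // !inE eqxx !orbT.
    by rewrite (Ra x y) // xy lb // !inE eqxx.
  by rewrite -(Ra y z) // yz lb // !inE eqxx orbT.
exists (fun x y => (x != y) && R x y); split=> [x|y x z|x y xy|P [x Px]].
- by rewrite eqxx.
- move=> /andP[xy Rxy] /andP[yz Ryz]; rewrite (Rt _ _ _ Rxy Ryz) andbT.
  by apply: contra xy => /eqP xz; rewrite -xz in Ryz; apply/eqP/Ra; rewrite Rxy.
- by rewrite xy eq_sym xy; apply: RT.
have [|z [[/asboolP Pz lb] _]] := Rwo (fun x => `[< P x >]).
  by exists x; apply/asboolP.
exists z => // y Py; rewrite negb_and negbK; case: eqVneq => //= yz.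
apply: contra yz => Ryz; apply/eqP/Ra; rewrite Ryz; apply: lb; exact/asboolP.
Qed.

(** The last element bounds the iterates in [ladder_rigid], so that they have a supremum. *)
Definition add_top (T : eqType) (lt : rel T) : rel (option T) := fun x y =>
  match x, y with
  | Some x, Some y => lt x y
  | Some _, None => true
  | None, _ => false
  end.

Lemma add_top_well_order (T : eqType) (lt : rel T) :
  strict_well_order lt -> strict_well_order (add_top lt).
Proof.
move=> [lti ltt ltT ltm]; split=> [[x|] //=|[y|] [x|] [z|] //=|[x|] [y|] //=|P [x Px]].
- exact: ltt.
- exact: ltT.
have [PS|noS] := pselect (exists x, P (Some x)).
  have [y Py ymin] := ltm _ PS.
  by exists (Some y) => // -[z|] // /ymin.
exists x => // -[y|] // Py; by case: noS; exists y.
Qed.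

(** * Ladders and rigidity *)

Section Ladder.
Context {X : eqType} {lt : rel X} (lt_wo : strict_well_order lt).

Let lt_irr : irreflexive lt. Proof. by case: lt_wo. Qed.
Let lt_trans : transitive lt. Proof. by case: lt_wo. Qed.
Let lt_total x y : x != y -> lt x y || lt y x.
Proof. by case: lt_wo => _ _ + _; apply. Qed.

Let nlt_trans x y z : ~~ lt y x -> lt y z -> lt x z.
Proof.
by have [-> //|/lt_total/orP[xy _ /(lt_trans xy)|->]] := eqVneq x y.
Qed.

(** The terms may reach [x] or exceed it, which admits the constant sequence [x]. *)
Definition cofinal_seq (c : nat -> X) (x : X) :=
  forall y, lt y x -> exists n, ~~ lt (c n) y.

(* The values of b lie below x when x has countable cofinality; any other x
   carries the junk ladder constantly equal to x. *)
Definition ladder_at (b : nat -> X) (x : X) := cofinal_seq b x /\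
  forall c, (forall n, lt (c n) x) -> cofinal_seq c x -> forall n, lt (b n) x.

Lemma ladder_exists : exists b : X -> nat -> X, forall x, ladder_at (b x) x.
Proof.
suff /choice[b bP] : forall x, exists b, ladder_at b x by exists b.
move=> x; have [[c [cx cc]]|noc] :=
  pselect (exists c, (forall n, lt (c n) x) /\ cofinal_seq c x).
  by exists c; split.
exists (fun=> x); split=> [y yx|c cx cc]; last by case: noc; exists c.
by exists 0; apply/negP => xy; have := lt_trans yx xy; rewrite lt_irr.
Qed.

(* Let d be the supremum of the iterates a < h a < h (h a) < ...: h fixes d, hence
   the ladder of d pointwise, although no point of [a, d) is fixed by h. *)
Lemma ladder_rigid (t : X) (lt_top : forall x, x != t -> lt x t)
    (b : X -> nat -> X) (h : X -> X) :
  (forall x, ladder_at (b x) x) ->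
  {homo h : x y / lt x y} ->
  (forall x n, h (b x n) = b (h x) n) -> forall x, h x = x.
Proof.
move=> bP hlt hb a; have [_ _ _ ltm] := lt_wo.
have hinfl x : ~~ lt (h x) x.
  apply/negP => hx.
  have [|y hy ymin] := ltm (fun x => lt (h x) x); first by exists x.
  by have := ymin _ (hlt _ _ hy); rewrite hy.
apply/eqP; apply: contraT => ha.
have {}ha : lt a (h a) by have := lt_total ha; rewrite (negPf (hinfl a)).
pose c n := iter n h a.
have cS n : lt (c n) (c n.+1) by elim: n => [//|n IHn]; apply: hlt.
have [|d cd dmin] := ltm (fun d => forall n, lt (c n) d).
  exists t => n; apply: (lt_top (c n)); apply/eqP => cn.
  have := cS n; rewrite cn => tS.
  have [St|nSt] := eqVneq (c n.+1) t; first by rewrite St lt_irr in tS.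
  by have := lt_trans tS (lt_top _ nSt); rewrite lt_irr.
have ccof : cofinal_seq c d.
  move=> y yd; apply: contrapT => noy.
  have /dmin : forall n, lt (c n) y.
    by move=> n; apply: contrapT => /negP cy; apply: noy; exists n.
  by rewrite yd.
(* The iterates show that [d] has countable cofinality, so its ladder is not the junk one. *)
have bd n : lt (b d n) d by have [_ /(_ c cd ccof)] := bP d.
have hd y : lt y d -> lt (h y) d.
  move=> /ccof[n cy]; have [->|ncy] := eqVneq y (c n); first exact: (cd n.+1).
  have := lt_total ncy; rewrite (negPf cy) orbF => /hlt ycS.
  exact: lt_trans ycS (cd n.+1).
(* If [d < h d], some rung of the ladder of [h d] is at least [d]; but its rungs are the
   [h (b d n)], all below [d]. *)
have hdd : h d = d.
  apply/eqP; apply: contraT => ndd.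
  have := lt_total ndd; rewrite (negPf (hinfl d)) => /= dhd.
  have [/(_ d dhd)[n] ] := bP (h d).
  by rewrite -hb (hd _ (bd n)).
(* A rung that is at least [a] is fixed by [h], so it bounds all iterates although it lies below
   their supremum [d]. *)
have [/(_ a (cd 0))[n bna] _] := bP d.
have hbn : h (b d n) = b d n by rewrite hb hdd.
have cb k : ~~ lt (b d n) (c k).
  elim: k => [//|k IHk]; apply/negP => bS.
  have [cbn|ncb] := eqVneq (c k) (b d n).
    by move: bS; rewrite /c iterS -/(c k) cbn hbn lt_irr.
  have := lt_total ncb; rewrite (negPf IHk) orbF => /hlt.
  by rewrite hbn => /(lt_trans bS); rewrite lt_irr.
have [k ck] := ccof _ (bd n).
by have := cb k.+1; rewrite (nlt_trans ck (cS k)).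
Qed.

(** * The digraph of a ladder system *)

(** Return arrows start at level 2: one from [(x, 1)] to [(x, 0)] would reverse an upward arrow and
    break asymmetry. *)
Inductive arrow (g : X -> nat -> X) : X * nat -> X * nat -> Prop :=
| ArrowLt x y of lt x y : arrow g (x, 0) (y, 0)
| ArrowUp x n : arrow g (x, n) (x, n.+1)
| ArrowDown x n : arrow g (x, n.+2) (g x n, 0).

Lemma arrow_asym g : asym (arrow g).
Proof.
move=> v w; case=> [x y xy|x n|x n] wv; last by inversion wv.
  inversion wv as [? ? yx| |]; subst.
  by have := lt_trans xy yx; rewrite lt_irr.
have neq2 : n.+2 <> n by elim: n {wv} => // n IHn [].
by inversion wv.
Qed.

Lemma arrow_serial g v : exists w, arrow g v w.
Proof. by case: v => x n; exists (x, n.+1); apply: ArrowUp. Qed.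

(** At [n = 0] there is no return arrow, and the third entry is only a default. *)
Lemma arrow_up_adj g x n v : arrow g (x, n.+1) v \/ arrow g v (x, n.+1) ->
  v \in [:: (x, n); (x, n.+2); (g x n.-1, 0)].
Proof. by case=> av; inversion av; subst; rewrite !inE eqxx ?orbT. Qed.

Context (s : seq X) (s_uniq : uniq s) (s_size : (4 < size s)%N).

(** Four elements other than [x] outnumber the three possible neighbours of a vertex above level
    0. *)
Let others x : exists t : seq X, [/\ uniq t, (3 < size t)%N & x \notin t].
Proof.
exists (rem x s); split; first exact: rem_uniq.
  have [xs|xs] := boolP (x \in s); last by rewrite rem_id //; apply: ltnW.
  by rewrite size_rem // ltn_predRL.
by rewrite mem_rem_uniq // inE eqxx.
Qed.

(** The only neighbours of [(y, 1)] are [(y, 0)] and [(y, 2)]. *)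
Lemma arrow_far g v : exists u u', [/\ u <> u',
  [/\ v <> u, ~ arrow g v u & ~ arrow g u v] &
  [/\ v <> u', ~ arrow g v u' & ~ arrow g u' v]].
Proof.
case: v => x n; have [[|y [|z t]] [//= yt _]] := others x.
rewrite !inE !negb_or => /and3P[/eqP xy /eqP xz _].
exists (y, 1), (z, 1); split.
- by move=> [yz]; move: yt; rewrite yz !inE eqxx.
- by split=> [[]//|a|a]; inversion a; subst.
- by split=> [[]//|a|a]; inversion a; subst.
Qed.

Lemma arrow_embedding g g' (f : X * nat -> X * nat) : injective f ->
  (forall v w, arrow g v w -> arrow g' (f v) (f w)) ->
  (forall v w, arrow g' (f v) (f w) -> arrow g v w \/ arrow g w v) ->
  exists2 h : X -> X, {homo h : x y / lt x y} &
    forall x n, h (g x n) = g' (h x) n.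
Proof.
move=> finj farr frefl.
have level0 x : exists y, f (x, 0) = (y, 0).
  case fx: (f (x, 0)) => [y [|n]]; first by exists y.
  have [t [t_uniq t_size xt]] := others x.
  (* (x, 0) has at least four neighbours, (y, n.+1) at most three *)
  have /uniq_leq_size : uniq [seq f (z, 0) | z <- t].
    by rewrite map_inj_uniq // => z z' /finj[].
  move=> /(_ [:: (y, n); (y, n.+2); (g' y n.-1, 0)]); rewrite size_map.
  move=> le3; have /le3 : {subset [seq f (z, 0) | z <- t] <=
      [:: (y, n); (y, n.+2); (g' y n.-1, 0)]}.
    move=> _ /mapP[z zt ->]; apply: arrow_up_adj; rewrite -fx.
    have /lt_total/orP[xz|zx] : x != z by apply: contra xt => /eqP ->.
      by left; apply/farr/ArrowLt.
    by right; apply/farr/ArrowLt.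
  by rewrite leqNgt t_size.
have [h hE] := choice level0.
(* Otherwise reflection makes [(x, n.+1)] adjacent to every [(z, 0)]; a [z] other than [x] and
   [g x n.-1] refutes this. *)
have levelS x n : exists y m, f (x, n.+1) = (y, m.+1).
  case fx: (f (x, n.+1)) => [y [|m]]; last by exists y, m.
  have [[|z [|z' t]] [//= zt _]] := others x.
  rewrite !inE !negb_or => /and3P[xz xz' _].
  have {z z' t zt xz xz'} [z xz gz] : exists2 z, x != z & g x n.-1 != z.
    have [gz|] := eqVneq (g x n.-1) z; last by exists z.
    by exists z' => //; rewrite gz; apply: contraTneq zt => ->; rewrite inE eqxx.
  suff : (z, 0) \in [:: (x, n); (x, n.+2); (g x n.-1, 0)].
    rewrite !inE !xpair_eqE ![z == _]eq_sym (negPf xz) (negPf gz).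
    by [].
  apply: arrow_up_adj.
  have /lt_total/orP[lt_y|lt_y] : y != h z.
    by apply/eqP => yz; have : (x, n.+1) = (z, 0) by apply: finj; rewrite fx hE yz.
    by apply: frefl; rewrite fx hE; apply: ArrowLt.
  suff /frefl[] : arrow g' (f (z, 0)) (f (x, n.+1)) by [right | left].
  by rewrite fx hE; apply: ArrowLt.
(* By [levelS] the image of an upward arrow ends above level 0, so it is again an upward arrow. *)
have fE x n : f (x, n) = (h x, n).
  elim: n => [|n IHn]; first exact: hE.
  have [y [m fx]] := levelS x n.
  have := farr _ _ (ArrowUp g x n); rewrite IHn fx => a; by inversion a.
exists h => [x y xy|x n].
  by have := farr _ _ (ArrowLt g xy); rewrite !fE => a; inversion a.
by have := farr _ _ (ArrowDown g x n); rewrite !fE => a; inversion a.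
Qed.

End Ladder.

Theorem theorem2 (I : Type) :
  exists (d : I -> Order.disp_t) (K : forall i, tbLatticeType (d i)),
    (forall i, simple_lattice (K i)) /\ mutually_rigid K.
Proof.
pose T : eqType := {classic (I + nat)%type}.
have [ltT ltT_wo] := strict_well_order_exists T.
pose X : eqType := option T; pose lt : rel X := add_top ltT.
have lt_wo : strict_well_order lt := add_top_well_order ltT_wo.
have lt_top (x : X) : x != None -> lt x None by case: x.
have [b bP] := ladder_exists lt_wo.
pose idx (i : I) : X := Some (inl i : T).
(* The mark of [i] is the value [None] at [idx i]; elsewhere the free value is [x] itself. *)
pose g i (x : X) n := if n is m.+1 then b x m else if x == idx i then None else x.
pose s : seq X := [seq Some (inr n : T) | n <- iota 0 5].
have s_uniq : uniq s by rewrite map_inj_uniq ?iota_uniq // => m n [].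
have s_size : (4 < size s)%N by rewrite size_map size_iota.
exists (fun=> Order.Disp tt tt), (fun i => flat (patch (arrow (lt := lt) (g i)))).
split=> [i|i j ij [f femb]].
  apply: digraph_lattice_simple; first exact: arrow_far s_uniq s_size _.
  by constructor; exact: (None, 0).
have asymA k : asym (arrow (lt := lt) (g k)) by exact: arrow_asym lt_wo _.
have [f0 f0inj [f0arr f0refl]] :=
  digraph_embedding (asymA i) (asymA j) (arrow_serial (g i)) femb.
have [h hlt hg] := arrow_embedding lt_wo s_uniq s_size f0inj f0arr f0refl.
have hid := ladder_rigid lt_wo lt_top bP hlt (fun x n => hg x n.+1).
(* As [h] is the identity, both digraphs have the mark [None] at [idx i], so [idx i = idx j]. *)
have := hg (idx i) 0; rewrite /g !hid eqxx.
by case: eqP => // -[].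
Qed.
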